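(* Let $G$ be a connected $2$-edge-colored multigraph on $n\ge 4$ vertices with $m$ edges. If $m\ge 2\binom{n-1}{2}+n$, then $G$ has a proper Hamiltonian cycle if $n$ is even, and a proper cycle of length $n-1$ if $n$ is odd.
   Context: A $c$-edge-colored multigraph has each edge colored with one color from $\{1,\dots,c\}$, and no two edges joining the same pair of vertices have the same color (no loops); $m$ counts all edges including parallel ones. Throughout, multigraphs are assumed connected. A subgraph is proper if any two adjacent edges in it have different colors. A proper Hamiltonian cycle is a properly colored cycle through all vertices; the length of a cycle is its number of vertices. *)

(* Defs.v *)
From mathcomp Require Import all_boot.

Set Implicit Arguments.
Unset Strict Implicit.
Unset Printing Implicit Defensive.

(* An edge is a color together with its set of two endpoints: loops are
   excluded by the cardinality condition, and since the edges form a set, two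
   parallel edges always have different colors. *)
Record cmultigraph (c : nat) (V : finType) := CMultigraph {
  edges : {set 'I_c * {set V}};
  edges_card2 : forall e, e \in edges -> #|e.2| = 2
}.

Section ColoredMultigraphs.
Variables (c : nat) (V : finType).
Implicit Types (G : cmultigraph c V) (F : {set 'I_c * {set V}}).

Definition adjacent G : rel V :=
  fun x y => [exists a : 'I_c, (a, [set x; y]) \in edges G].

Definition connected G : Prop := forall x y : V, connect (adjacent G) x y.

Definition proper_edges F : Prop :=
  forall e f, e \in F -> f \in F -> e != f -> e.2 :&: f.2 != set0 ->
  e.1 != f.1.

(* The i-th edge of the closed walk v_0, ..., v_{k-1}, v_0 joins v_i to
   v_{i+1}, indices being taken modulo k, and has color [col i]. *)
Definition cycle_edge k (v : 'I_k -> V) (col : 'I_k -> 'I_c) (i : 'I_k) :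
    'I_c * {set V} :=
  (col i, [set v i; v (ordS i)]).

(* Injectivity of [cycle_edge] only matters for k = 2, where it says that the
   two edges are distinct parallel edges. *)
Definition is_cycle G k (v : 'I_k -> V) (col : 'I_k -> 'I_c) : Prop :=
  [/\ 1 < k, injective v, injective (cycle_edge v col)
    & forall i, cycle_edge v col i \in edges G].

Definition is_proper_cycle G k (v : 'I_k -> V) (col : 'I_k -> 'I_c) : Prop :=
  is_cycle G v col /\ proper_edges [set cycle_edge v col i | i : 'I_k].

Definition has_proper_cycle_of_length G (k : nat) : Prop :=
  exists (v : 'I_k -> V) (col : 'I_k -> 'I_c), is_proper_cycle G v col.

Definition has_proper_hamiltonian_cycle G : Prop :=
  exists k (v : 'I_k -> V) (col : 'I_k -> 'I_c),
    is_proper_cycle G v col /\ forall x : V, exists i, v i = x.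

End ColoredMultigraphs.

(* Main.v *)
(* Average over all placements of a k-cycle with alternating colors, k even and
   4 <= k <= n.  An ordered pair of distinct vertices is mapped by a uniform
   permutation to a uniform ordered pair, and swapping the two colors makes
   both equally likely on each edge, so each of the n(n-1) - m <= n - 2 missing
   edges is hit with probability k / (n(n-1)).  The expected number of missing
   edges on the cycle is thus at most k(n-2) / (n(n-1)) < 1, and some placement
   uses no missing edge.  Take k = n for n even and k = n - 1 for n odd. *)
Require Import Defs.
From mathcomp Require Import all_boot.
From mathcomp Require Import fingroup perm zify.

Set Implicit Arguments.
Unset Strict Implicit.
Unset Printing Implicit Defensive.

Section PermutationAverage.
Variable T : finType.

(** The first transposition sends [x] to [x']; the second corrects the image of [y] and fixes [x'],
    which differs from that image and from [y']. *)
Lemma perm_2transitive (x y x' y' : T) : x != y -> x' != y' ->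
  exists t : {perm T}, t x = x' /\ t y = y'.
Proof.
move=> xy xy'; exists (tperm x x' * tperm (tperm x x' y) y')%g.
rewrite !permM tpermL; split; last by rewrite tpermL.
by rewrite tpermD // 1?eq_sym // -[eqbLHS](tpermL x x') (inj_eq perm_inj).
Qed.

Lemma card_distinct_pairs :
  #|[pred p : T * T | p.1 != p.2]| = #|T| * #|T|.-1.
Proof.
rewrite -sum1_card -(pair_big_dep xpredT (fun x y => x != y) (fun _ _ => 1)) /=.
rewrite -sum_nat_const; apply: eq_bigr => x _; rewrite sum1_card -(cardC1 x).
by apply: eq_card => y; rewrite !inE eq_sym.
Qed.

(** Uniformity of the image of a pair, with denominators cleared. Double counting over [s] and
    distinct pairs: the sum over [s] is the same for every pair, by translating [s], and each [s]
    permutes the distinct pairs. *)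
Lemma sum_perm_pair (f : T -> T -> nat) (x y : T) : x != y ->
  #|T| * #|T|.-1 * (\sum_(s : {perm T}) f (s x) (s y)) =
  #|{perm T}| * \sum_(p : T * T | p.1 != p.2) f p.1 p.2.
Proof.
move=> xy; rewrite -card_distinct_pairs -!sum_nat_const.
transitivity (\sum_(p : T * T | p.1 != p.2)
                 \sum_(s : {perm T}) f (s p.1) (s p.2)).
  apply: eq_bigr => -[x' y'] /= xy'.
  have [t [<- <-]] := perm_2transitive xy (xy' : x' != y').
  rewrite (reindex_inj (mulgI t)) /=; apply: eq_bigr => s _.
  by rewrite !permM.
rewrite exchange_big; apply: eq_bigr => s _.
rewrite [RHS](reindex (fun p : T * T => (s p.1, s p.2))) /=.
  by apply: eq_bigl => p; rewrite (inj_eq perm_inj).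
exists (fun p => (s^-1%g p.1, s^-1%g p.2)) => -[a b] _ /=;
  by rewrite ?permK ?permKV.
Qed.

End PermutationAverage.

Section MissingEdges.
Variables (c : nat) (V : finType) (G : cmultigraph c V).

Definition missing (a : 'I_c) (x y : V) : nat := (a, [set x; y]) \notin edges G.

(** Each edge is counted at both orderings of its endpoints. *)
Lemma double_edges_le :
  2 * #|edges G| <=
  \sum_(p : V * V | p.1 != p.2) \sum_a ((a, [set p.1; p.2]) \in edges G).
Proof.
rewrite (eq_bigr (fun p : V * V =>
    \sum_(e in edges G) (e.2 == [set p.1; p.2]))); last first.
  move=> [x y] _ /=.
  transitivity (\sum_a \sum_A
      if (a, A) \in edges G then (A == [set x; y] : nat) else 0); last first.
    by rewrite pair_big [RHS]big_mkcond; apply: eq_bigr => -[].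
  apply: eq_bigr => a _; rewrite (bigD1 [set x; y]) //= eqxx big1 ?addn0.
    by case: ifP.
  by move=> A /negPf ->; case: ifP.
rewrite exchange_big mulnC -sum_nat_const /=; apply: leq_sum => e eG.
have /eqP/cards2P [x [y [xy ->]]] := edges_card2 eG.
rewrite (bigD1 (x, y)) //= (bigD1 (y, x)) /=; last first.
  by rewrite eq_sym xy xpair_eqE negb_and eq_sym xy.
by rewrite eqxx setUC eqxx.
Qed.

Lemma sum_missing_le :
  (\sum_(p : V * V | p.1 != p.2) \sum_a missing a p.1 p.2) + 2 * #|edges G|
  <= c * (#|V| * #|V|.-1).
Proof.
apply: leq_trans (leq_add (leqnn _) double_edges_le) _.
rewrite -big_split /= mulnC -card_distinct_pairs -sum_nat_const.
apply: leq_sum => p _; rewrite -big_split /= -[leqRHS](card_ord c) -sum1_card.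
by apply: leq_sum => a _; rewrite /missing; case: (_ \in _).
Qed.

End MissingEdges.

Lemma odd_ordS k (i : 'I_k) : ~~ odd k -> odd (ordS i) = ~~ odd i.
Proof.
move=> ke; case: i => i ik /=.
by have [e|e] := eqVneq i.+1 k; [rewrite e modnn; lia | rewrite modn_small; lia].
Qed.

Lemma ordS_neq k (i : 'I_k) : 1 < k -> ordS i != i.
Proof.
move=> k1; rewrite -val_eqE /=; case: i => i ik /=.
by have [e|e] := eqVneq i.+1 k; [rewrite e modnn; lia | rewrite modn_small; lia].
Qed.

Lemma ordS2_neq k (i : 'I_k) : 2 < k -> ordS (ordS i) != i.
Proof.
move=> k2; rewrite -val_eqE /=; case: i => i ik /=.
have [e|e] := eqVneq i.+1 k; first by rewrite e modnn modn_small; lia.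
rewrite [i.+1 %% k]modn_small; last lia.
by have [e2|e2] := eqVneq i.+2 k; [rewrite e2 modnn; lia | rewrite modn_small; lia].
Qed.

Section AlternatingCycles.
Variables (V : finType) (G : cmultigraph 2 V) (k : nat).

Definition alternating (b : bool) (i : 'I_k) : 'I_2 :=
  if odd i (+) b then ord_max else ord0.

Lemma alternating_ordS b i :
  ~~ odd k -> alternating b (ordS i) != alternating b i.
Proof. by move=> ke; rewrite /alternating odd_ordS //; case: odd b => -[]. Qed.

Lemma alternating_is_proper_cycle (v : 'I_k -> V) b :
  2 < k -> ~~ odd k -> injective v ->
  (forall i, cycle_edge v (alternating b) i \in edges G) ->
  is_proper_cycle G v (alternating b).
Proof.
move=> k2 ke vI vG.
(* As [v] is injective, only equal or cyclically consecutive edges meet; consecutive ones differ in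
   color because [k] is even. *)
have meet i j : [set v i; v (ordS i)] :&: [set v j; v (ordS j)] != set0 ->
    [\/ i = j, i = ordS j | j = ordS i].
  case/set0Pn=> x; rewrite !inE => /andP[/orP[]/eqP-> /orP[]/eqP/vI].
  - by move->; apply: Or31.
  - by move->; apply: Or32.
  - by move<-; apply: Or33.
  - by move/ordS_inj->; apply: Or31.
split; first split=> //; first lia.
  move=> i j [alt_eq set_eq].
  have [| // | ij | ji] := meet i j.
  - by apply/set0Pn; exists (v i); rewrite -set_eq setIid !inE eqxx.
  - by move: alt_eq (alternating_ordS b j ke); rewrite ij => ->; rewrite eqxx.
  - by move: alt_eq (alternating_ordS b i ke); rewrite ji => ->; rewrite eqxx.
move=> e f /imsetP[i _ ->] /imsetP[j _ ->] ne /meet[ij|->|->] /=.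
- by rewrite ij eqxx in ne.
- exact: alternating_ordS.
- by rewrite eq_sym alternating_ordS.
Qed.

(** The last hypothesis says that fewer than [#|V|.-1] of the possible colored edges are missing. *)
Lemma exists_alternating_cycle :
  2 < k <= #|V| -> ~~ odd k -> #|V| * #|V|.-1 < #|edges G| + #|V|.-1 ->
  exists (v : 'I_k -> V) b, injective v /\ is_proper_cycle G v (alternating b).
Proof.
move=> /andP[k2 kn] ke mG.
(* A fixed reference placement; the average runs over its images [s \o w] and both color phases
   [b]. *)
pose w (i : 'I_k) : V := enum_val (widen_ord kn i).
have wI : injective w.
  by move=> i j /enum_val_inj /(congr1 val) /= ij; apply: val_inj.
pose hits (s : {perm V}) b :=
  \sum_i missing G (alternating b i) (s (w i)) (s (w (ordS i))).
have [/existsP[s /existsP[b /eqP hit0]] | /existsPn no_hit0] :=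
    boolP [exists s, exists b, hits s b == 0].
  have swI : injective (s \o w) by apply: inj_comp wI; apply: perm_inj.
  exists (s \o w), b; split=> //; apply: alternating_is_proper_cycle => // i.
  move/eqP: hit0; rewrite sum_nat_eq0 => /forallP/(_ i) /=.
  by rewrite /missing eqb0 negbK.
(* Otherwise each of the two phases of each permutation hits a missing edge. *)
have lower : 2 * #|{perm V}| <= \sum_s \sum_b hits s b.
  rewrite mulnC -sum_nat_const; apply: leq_sum => s _.
  have /existsPn pos := no_hit0 s.
  by rewrite big_bool -[2]/(1 + 1) leq_add // lt0n pos.
(* Twice the number of missing edges, as pairs are ordered. *)
pose D := \sum_(p : V * V | p.1 != p.2) \sum_a missing G a p.1 p.2.
have total : #|V| * #|V|.-1 * (\sum_s \sum_b hits s b) = k * (#|{perm V}| * D).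
  have -> : \sum_s \sum_b hits s b =
      \sum_(i < k) \sum_(s : {perm V}) \sum_a missing G a (s (w i)) (s (w (ordS i))).
    rewrite [RHS]exchange_big /=; apply: eq_bigr => s _.
    rewrite exchange_big /=; apply: eq_bigr => i _.
    (* At a fixed position the two phases use each color once. *)
    rewrite big_bool big_ord_recl big_ord1 /alternating.
    have -> : lift ord0 ord0 = ord_max :> 'I_2 by apply: val_inj.
    by case: odd; rewrite /= // addnC.
  rewrite big_distrr /= -[X in _ = X * _](card_ord k) -[RHS]sum_nat_const.
  apply: eq_bigr => i _.
  rewrite (sum_perm_pair (fun x y => \sum_a missing G a x y)) //.
  by rewrite (inj_eq wI) eq_sym ordS_neq // ltnW.
have D_le : D + 2 * #|edges G| <= 2 * (#|V| * #|V|.-1) := sum_missing_le G.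
have perm_gt0 : 0 < #|{perm V}| by apply/card_gt0P; exists 1%g.
have bad : #|V| * #|V|.-1 * (2 * #|{perm V}|) <= #|V| * (#|{perm V}| * D).
  apply: leq_trans (leq_mul (leqnn _) lower) _.
  by rewrite total leq_mul2r kn orbT.
(* Cancelling the common factor gives [2 * #|V|.-1 <= D], against [D_le] and [mG]. *)
have : #|V| * #|{perm V}| * (2 * #|V|.-1) <= #|V| * #|{perm V}| * D by lia.
by rewrite leq_pmul2l; [lia | rewrite muln_gt0 perm_gt0 andbT; lia].
Qed.

End AlternatingCycles.

Theorem theorem3 (V : finType) (G : cmultigraph 2 V) (n m : nat)
    (hn : #|V| = n) (hm : #|edges G| = m) (hn4 : 4 <= n)
    (hconn : connected G) (hbound : 2 * 'C(n.-1, 2) + n <= m) :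
  (~~ odd n -> has_proper_hamiltonian_cycle G) /\
  (odd n -> has_proper_cycle_of_length G n.-1).
Proof.
have bound : #|V| * #|V|.-1 < #|edges G| + #|V|.-1.
  (* Twice the binomial is (n-1)(n-2), and (n-1)(n-2) + n = n(n-1) - (n-2). *)
  have := mul_bin_diag n.-1 1; rewrite bin1 => bin2E.
  by rewrite hn hm; case: n hn4 bin2E hbound {hn} => [|[|n]] //=; nia.
split=> parity.
  have [||v [b [vI vP]]] := @exists_alternating_cycle V G n _ _ bound => //.
    by rewrite hn leqnn andbT ltnW.
  exists n, v, (alternating b); split=> // x.
  have [g _ gK] : bijective v by apply: inj_card_bij; rewrite // card_ord hn.
  by exists (g x).
have [||v [b [_ vP]]] := @exists_alternating_cycle V G n.-1 _ _ bound.
- by rewrite hn; lia.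
- by lia.
by exists v, (alternating b).
Qed.
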